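(* Let $(X,\mathcal U)$ be a sequentially Lebesgue $g$-quasi uniform space. If $\mathcal U$ has a countable base, then $(X,\mathcal U)$ is weak $G$-complete.
   Context: A $g$-quasi uniformity (generalized quasi-uniformity) on a nonempty set $X$ is a nonempty collection $\mathcal U\subset\mathcal P(X\times X)$ such that (i) $\Delta(X)=\{(x,x):x\in X\}\subset U$ for all $U\in\mathcal U$; (ii) $U\in\mathcal U$ and $U\subset V\subset X\times X$ imply $V\in\mathcal U$; (iii) for each $U\in\mathcal U$ there is $V\in\mathcal U$ with $V\circ V\subset U$, where $V\circ V=\{(x,z):\exists y,\ (x,y)\in V,(y,z)\in V\}$. (Closure under intersection is not required.) The pair $(X,\mathcal U)$ is called a $g$-quasi uniform space. A nonempty $\mathcal B\subset\mathcal U$ is a base for $\mathcal U$ if every $V\in\mathcal U$ contains some $B\in\mathcal B$. For $U\in\mathcal U$ and $x\in X$ put $U(x)=\{y\in X:(x,y)\in U\}$. The collection $\mu(\mathcal U)=\{G\subset X: \text{for every }x\in G\text{ there is }U\in\mathcal U\text{ with }U(x)\subset G\}$ is the induced supratopology. A generalized neighborhood of $a\in X$ is a set $A\subset X$ with $a\in G\subset A$ for some $G\in\mu(\mathcal U)$. Let $(x_n)_{n\in\mathbb N}$ be a sequence in $X$. A point $c\in X$ is a cluster point of $(x_n)$ if for every generalized neighborhood $A$ of $c$ and every $n\in\mathbb N$ there is $m\ge n$ with $x_m\in A$. The sequence is pseudo-Cauchy if for every $U\in\mathcal U$ and $p\in\mathbb N$ there exist $m\neq n$ in $\mathbb N$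 with $m,n\ge p$ and $(x_m,x_n)\in U$. It is $G$-Cauchy if for every $U\in\mathcal U$ there is $k\in\mathbb N$ such that $(x_n,x_{n+1})\in U$ for all $n\ge k$. $(X,\mathcal U)$ is sequentially Lebesgue if every pseudo-Cauchy sequence with distinct terms (i.e. $x_m\ne x_n$ for all $m\neq n$) has a cluster point in $X$. It is weak $G$-complete if every $G$-Cauchy sequence in $X$ has a cluster point in $X$. *)

(* Defs.v *)
From mathcomp Require Import all_boot.
From mathcomp Require Import boolp classical_sets functions cardinality.

Set Implicit Arguments.
Unset Strict Implicit.
Unset Printing Implicit Defensive.

Local Open Scope classical_set_scope.

(* A family of subsets of X * X, not assumed closed under intersections:
   it need not be a filter, so the entourages of [uniformType] do not apply. *)
Definition g_quasi_uniformity (X : Type) (U : set (set (X * X))) : Prop :=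
  [/\ [set: X] !=set0,
      U !=set0,
      forall A, U A -> diagonal `<=` A,
      forall A B, U A -> A `<=` B -> U B &
      forall A, U A -> exists2 B, U B & (B \; B)%relation `<=` A].

Definition g_quasi_base (X : Type) (U B : set (set (X * X))) : Prop :=
  [/\ B !=set0, B `<=` U & forall V, U V -> exists2 W, B W & W `<=` V].

Definition supratopology (X : Type) (U : set (set (X * X))) : set (set X) :=
  [set G | forall x, G x -> exists2 V, U V & xsection V x `<=` G].

Definition generalized_nbhs (X : Type) (U : set (set (X * X))) (a : X) :
    set (set X) :=
  [set A | exists G, [/\ supratopology U G, G a & G `<=` A]].

(* The library's [cluster] is about filters of neighborhoods, whereas the
   generalized neighborhoods of a point need not form a filter. *)
Definition cluster_point (X : Type) (U : set (set (X * X))) (x : nat -> X)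
    (c : X) : Prop :=
  forall A, generalized_nbhs U c A ->
  forall n : nat, exists2 m : nat, n <= m & A (x m).

Definition pseudo_Cauchy (X : Type) (U : set (set (X * X))) (x : nat -> X) :
    Prop :=
  forall V, U V -> forall p : nat,
  exists m n : nat, [/\ m <> n, p <= m, p <= n & V (x m, x n)].

Definition G_Cauchy (X : Type) (U : set (set (X * X))) (x : nat -> X) : Prop :=
  forall V, U V -> exists k : nat, forall n : nat, k <= n -> V (x n, x n.+1).

Definition sequentially_Lebesgue (X : Type) (U : set (set (X * X))) : Prop :=
  forall x : nat -> X, pseudo_Cauchy U x ->
  (forall m n : nat, m <> n -> x m <> x n) ->
  exists c, cluster_point U x c.

Definition weak_G_complete (X : Type) (U : set (set (X * X))) : Prop :=
  forall x : nat -> X, G_Cauchy U x -> exists c, cluster_point U x c.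

(* Main.v *)
Require Import Defs.
From mathcomp Require Import all_boot.
From mathcomp Require Import boolp classical_sets functions cardinality.

(** Argue by contradiction: let [x] be a [G]-Cauchy sequence without cluster
    points.  A value taken infinitely often is a cluster point
    ([cluster_point_recurrent]), so [x] takes every value finitely often; hence
    it eventually leaves any finite set of values ([escapes_initial_values]) and
    has arbitrarily late jumps [x n <> x n.+1].

    Enumerate the countable base as [V 0, V 1, ...] with every member listed
    infinitely often ([countable_enum_recurrent]).  Pick jump positions [s k]
    one after the other, each so late that [(x (s k), x (s k).+1)] lies in [V k]
    and that no earlier chosen value ever comes back
    ([separated_subsequence]).  The interleaved sequence
    [x (s 0), x (s 0).+1, x (s 1), x (s 1).+1, ...] has distinct terms, and is
    pseudo-Cauchy because each entourage contains a pair of consecutive terms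
    arbitrarily late.  The sequential Lebesgue property gives it a cluster
    point, which is also one of [x] ([cluster_point_comp]).

    Repetition in the enumeration takes the place of the usual passage to a
    decreasing base, which would require finite intersections of entourages. *)

Set Implicit Arguments.
Unset Strict Implicit.
Unset Printing Implicit Defensive.

Local Open Scope classical_set_scope.

Lemma cluster_point_recurrent (X : Type) (U : set (set (X * X)))
    (x : nat -> X) (c : X) :
  (forall n, exists2 m, n <= m & x m = c) -> cluster_point U x c.
Proof.
move=> xc A [G [_ Gc GA]] n; have [m nm xmc] := xc n.
by exists m => //; apply: GA; rewrite xmc.
Qed.

Lemma cluster_point_comp (X : Type) (U : set (set (X * X)))
    (x : nat -> X) (t : nat -> nat) (c : X) :
  (forall m, m <= t m) -> cluster_point U (x \o t) c -> cluster_point U x c.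
Proof.
move=> le_t xtc A Ac n; have [m nm Am] := xtc A Ac n.
by exists (t m) => //; apply: leq_trans nm (le_t m).
Qed.

(** Precomposing an enumeration with the 2-adic valuation, whose fibres are
    all infinite, repeats each of its values infinitely often. *)
Lemma countable_enum_recurrent (T : Type) (B : set T) :
  countable B -> B !=set0 ->
  exists2 f : nat -> T, forall n, B (f n) &
    forall b, B b -> forall p, exists2 k, p <= k & f k = b.
Proof.
move=> /pfcard_geP[->|[f]] B0; first by case: B0.
exists (fun k => f (logn 2 k)) => [n|b Bb p]; first exact: funS.
have [i _ <-] := @surj _ _ _ _ f b Bb.
exists (2 ^ i * 3 ^ p).
  by apply: leq_trans (ltnW (ltn_expl p (isT : 1 < 3))) _; rewrite leq_pmull ?expn_gt0.
by rewrite lognM ?expn_gt0 // pfactorK // lognX logn_prime //= muln0 addn0.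
Qed.

Lemma escapes_initial_values (X : Type) (x : nat -> X) :
  (forall c, exists M, forall m, M <= m -> x m <> c) ->
  forall N, exists M, forall j m, j <= N -> M <= m -> x m <> x j.
Proof.
move=> esc; elim=> [|N [M xM]].
  have [M xM] := esc (x 0); exists M => j m; rewrite leqn0 => /eqP ->.
  exact: xM.
have [M' xM'] := esc (x N.+1); exists (maxn M M') => j m.
rewrite geq_max leq_eqVlt => /predU1P[->|jN] /andP[Mm M'm]; first exact: xM'.
exact: xM.
Qed.

(** The bound [(s k).+1], rather than [s k], leaves room for taking two
    consecutive terms of [x] at each stage. *)
Lemma separated_subsequence (X : Type) (x : nat -> X) (P : nat -> nat -> Prop) :
  (forall c, exists M, forall m, M <= m -> x m <> c) ->
  (forall k N, exists2 n, N <= n & P k n) ->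
  exists s : nat -> nat,
    [/\ forall k, P k (s k), forall k, (s k).+1 < s k.+1 &
        forall k l i j, k < l -> i <= (s k).+1 -> s l <= j -> x j <> x i].
Proof.
move=> /escapes_initial_values esc Pfreq.
have step (a : nat * nat) : exists n, [/\ P a.1 n, a.2 < n &
    forall i j, i <= a.2 -> n <= j -> x j <> x i].
  have [M xM] := esc a.2; have [n] := Pfreq a.1 (maxn M a.2.+1).
  rewrite geq_max => /andP[Mn an] Pn; exists n; split => // i j ia nj.
  exact: xM ia (leq_trans Mn nj).
have [g gP] := choice step.
pose fix s k := if k is k'.+1 then g (k, (s k').+1) else g (0, 0).
have ltS k : (s k).+1 < s k.+1 by have [] := gP (k.+1, (s k).+1).
exists s; split=> // [[|k]|k l i j kl ik lj].
- by have [] := gP (0, 0).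
- by have [] := gP (k.+1, (s k).+1).
have s_mono : {homo s : m n / m <= n}.
  by apply: homo_leq => [//|//|m]; [exact: leq_trans|exact: ltnW (ltnW (ltS m))].
have [_ _] := gP (k.+1, (s k).+1); apply => //.
exact: leq_trans (s_mono _ _ kl) lj.
Qed.

Theorem theorem3p9 (X : Type) (U : set (set (X * X))) :
  g_quasi_uniformity U ->
  sequentially_Lebesgue U ->
  (exists B : set (set (X * X)), g_quasi_base U B /\ countable B) ->
  weak_G_complete U.
Proof.
move=> _ Leb [B [[B0 BU Ubase] cB]] x xG; apply: contrapT => noc.
have esc c : exists M, forall m, M <= m -> x m <> c.
  apply: contrapT => freq; apply: noc; exists c.
  apply: cluster_point_recurrent => n; apply: contrapT => nxc.
  by apply: freq; exists n => m nm xmc; apply: nxc; exists m.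
have jump N : exists2 n, N <= n & x n <> x n.+1.
  apply: contrapT => nojump; have [M xM] := esc (x N).
  have const d : x (N + d) = x N.
    elim: d => [|d IHd]; first by rewrite addn0.
    rewrite -IHd addnS; apply: contrapT => xd; apply: nojump.
    by exists (N + d); [exact: leq_addr|move=> e; apply: xd].
  exact: xM (leq_addl N M) (const M).
have [V BV Vrec] := countable_enum_recurrent cB B0.
have freq k N : exists2 n, N <= n & x n <> x n.+1 /\ V k (x n, x n.+1).
  have [M xM] := xG _ (BU _ (BV k)); have [n] := jump (maxn N M).
  by rewrite geq_max => /andP[Nn Mn] xn; exists n => //; split => //; exact: xM.
have [s [sP ltS sep]] := separated_subsequence esc freq.
pose t m := s m./2 + odd m.
have le_t m : m <= t m.
  rewrite /t -{1}(odd_double_half m) addnC leq_add2r.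
  elim: m./2 => // k IHk; rewrite doubleS.
  exact: leq_ltn_trans _ (ltS k).
have t_distinct a b : a < b -> x (t b) <> x (t a).
  move=> ab; have := half_leq (ltnW ab); rewrite leq_eqVlt => /predU1P[hab|hab].
    (* [a] and [b] are the two positions of the same pair *)
    have [oa ob] : odd a = false /\ odd b = true.
      move: ab; rewrite -(odd_double_half a) -(odd_double_half b) hab ltn_add2r.
      by rewrite !oddD !odd_double !addbF; case: (odd a); case: (odd b).
    rewrite /t hab oa ob addn0 addn1; have [+ _] := sP b./2.
    by move=> xb e; apply: xb.
  apply: sep hab _ _; rewrite /t ?leq_addr //.
  by rewrite -addn1 leq_add2l leq_b1.
have [|m n mn|c xtc] := Leb (x \o t).
- move=> W /Ubase[b /Vrec bV bW] p; have [k pk Vk] := bV p.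
  have pk2 : p <= k.*2 by rewrite -addnn (leq_trans pk (leq_addr _ _)).
  exists k.*2, k.*2.+1; split => //.
    exact: leqW pk2.
  apply: bW; rewrite /= /t /= uphalf_double doubleK odd_double addn0 addn1 -Vk.
  by have [] := sP k.
- have [/t_distinct xmn e|/t_distinct //|//] := ltngtP m n.
  exact: xmn.
by apply: noc; exists c; exact: cluster_point_comp xtc.
Qed.
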